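(* Let $\mathbb{S}$ be a metric space, let the sequence of measures $\{\mu_n\}_{n\ge 1}$ on $\mathbb{S}$ converge weakly to a finite measure $\mu$ on $\mathbb{S}$, let $\{f_n\}_{n\ge 1}$ be a lower semi-equicontinuous sequence of real-valued functions on $\mathbb{S}$, and let $f$ be a measurable real-valued function on $\mathbb{S}$. All integrals appearing in this statement are assumed to be defined. Suppose that: (i) the sequence $\{f_n\}_{n\ge 1}$ lower semi-converges to $f$ in measure $\mu$; (ii) either (a) $\{f_n^-\}_{n\ge 1}$ is asymptotically uniformly integrable with respect to $\{\mu_n\}_{n\ge 1}$, or (b) there exists a sequence of measurable real-valued functions $\{g_n\}_{n\ge 1}$ on $\mathbb{S}$ such that $f_n(s)\ge g_n(s)$ for all $n\ge 1$ and $s\in\mathbb{S}$, and $$-\infty<\int_{\mathbb{S}}\limsup_{n\to\infty,\,s'\to s} g_n(s')\,\mu(ds)\le\liminf_{n\to\infty}\int_{\mathbb{S}} g_n(s)\,\mu_n(ds).$$ Then $$\int_{\mathbb{S}} f(s)\,\mu(ds)\le\liminf_{n\to\infty}\int_{\mathbb{S}} f_n(s)\,\mu_n(ds).$$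
   Context: Metric spaces carry their Borel $\sigma$-field. For a function $h$, $h^+=\max\{h,0\}$ and $h^-=-\min\{h,0\}$. The integral $\int h\,d\mu$ of a measurable $[-\infty,+\infty]$-valued function is defined if $\min\{\int h^+d\mu,\int h^-d\mu\}<+\infty$, and then equals $\int h^+d\mu-\int h^-d\mu$. Weak convergence: $\{\mu_n\}$ converges weakly to a finite measure $\mu$ if $\int h\,d\mu_n\to\int h\,d\mu$ for every bounded continuous function $h$ on $\mathbb{S}$ (so $\mu_n$ is finite for all sufficiently large $n$). Lower semi-equicontinuity: $\{f_n\}$ is lower semi-equicontinuous if for each $s\in\mathbb{S}$ and each $\varepsilon>0$ there is $\delta>0$ such that $f_n(s')>f_n(s)-\varepsilon$ for all $s'\in B_\delta(s)$ (open ball) and all $n\ge 1$. Lower semi-convergence in measure: measurable functions $f_n$ lower semi-converge to a measurable real-valued $f$ in measure $\mu$ if for each $\varepsilon>0$, $\mu(\{s: f_n(s)\le f(s)-\varepsilon\})\to 0$ as $n\to\infty$. Asymptotic uniform integrability: $\{h_n\}$ is asymptotically uniformly integrable with respect to $\{\mu_n\}$ if $\lim_{K\to+\infty}\limsup_{n\to\infty}\int |h_n(s)|\,\mathbf{1}\{|h_n(s)|\ge K\}\,\mu_n(ds)=0$. Double limits: $\limsup_{n\to\infty,\,s'\to s} g_n(s')=\inf_{n\ge1,\,\delta>0}\ \sup_{k\ge n,\,s'\in B_\delta(s)} g_k(s')$ (the point $s'=s$ is allowed). *)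

(* Defs.v *)
From HB Require Import structures.
From mathcomp Require Import all_boot all_order all_algebra.
From mathcomp Require Import all_classical all_reals all_analysis.
From mathcomp Require Import measurable_realfun.

Set Implicit Arguments.
Unset Strict Implicit.
Unset Printing Implicit Defensive.

Import Order.TTheory GRing.Theory Num.Theory.
Import numFieldNormedType.Exports.

Local Open Scope classical_set_scope.
Local Open Scope ring_scope.

(* The library's measurable types carry a chosen point, so a metric space has
   to be pointed (i.e. nonempty) in order to carry measures. *)
#[short(type="pmetricType")]
HB.structure Definition PointedMetric (K : numDomainType) :=
  {M of Metric K M & isPointed M}.

(* A copy of S whose sigma-algebra is generated by the open sets; it keeps the
   metric structure of S. *)
Definition borel (R : realType) (S : pmetricType R) : Type :=
  g_sigma_algebraType (@open S).

Section borel_instances.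
Variables (R : realType) (S : pmetricType R).

HB.instance Definition _ := Measurable.on (borel S).
HB.instance Definition _ := Metric.copy (borel S) S.

End borel_instances.

Section integrals.
Context d (T : measurableType d) (R : realType).
Local Open Scope ereal_scope.

(* When this fails because both parts are infinite, the library's integral
   takes the conventional value +oo - oo = -oo. *)
Definition integral_defined (mu : {measure set T -> \bar R}) (h : T -> \bar R) :=
  measurable_fun setT h /\
  mine (\int[mu]_s h^\+ s) (\int[mu]_s h^\- s) < +oo.

(* Meant for measurable f_ n and f. *)
Definition lower_semi_converges_in_measure (mu : {measure set T -> \bar R})
    (f_ : (T -> R)^nat) (f : T -> R) :=
  forall e : R, (0 < e)%R ->
    mu [set s | (f_ n s <= f s - e)%R] @[n --> \oo] --> 0.

Definition asymptotically_uniformly_integrable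
    (mu_ : {measure set T -> \bar R}^nat) (h_ : (T -> R)^nat) :=
  limn_esup (fun n =>
    \int[mu_ n]_(s in [set s | (K <= `|h_ n s|)%R]) `|h_ n s|%:E)
  @[K --> +oo%R] --> 0.

End integrals.

Section metric.
Variables (R : realType) (S : pmetricType R).

(* The limit is taken in \bar R: finitely many of the mu_ n may be infinite. *)
Definition weakly_converges (mu_ : {measure set (borel S) -> \bar R}^nat)
    (mu : {finite_measure set (borel S) -> \bar R}) :=
  forall h : borel S -> R, continuous h -> [bounded h s | s in setT] ->
    (\int[mu_ n]_s (h s)%:E)%E @[n --> \oo] --> (\int[mu]_s (h s)%:E)%E.

(* Every f_ n is then lower semicontinuous, hence Borel measurable. *)
Definition lower_semi_equicontinuous (f_ : (S -> R)^nat) :=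
  forall (s : S) (e : R), 0 < e -> exists2 delta : R, 0 < delta &
    forall n s', ball s delta s' -> f_ n s - e < f_ n s'.

Definition joint_limsup (g_ : (S -> R)^nat) (s : S) : \bar R :=
  ereal_inf [set ereal_sup [set (g_ k s')%:E |
      k in [set k | (n <= k)%N] & s' in ball s delta]
    | n in [set: nat] & delta in [set delta : R | 0 < delta]].

End metric.

(* Main.v *)
Require Import Defs.
From mathcomp Require Import all_boot all_order all_algebra.
From mathcomp Require Import all_classical all_reals all_analysis.
From mathcomp Require Import measurable_realfun.
From mathcomp Require Import lra.

(** If the limit inferior of the integrals were below a real [c] smaller than
    the integral of [f], then along a subsequence all integrals of [f_ n] would
    be at most [c] and, by Borel-Cantelli, [f] would be at most the limit
    inferior of [f_ n] almost everywhere; lower semi-equicontinuity upgrades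
    this pointwise bound to the joint limit inferior in [(n, s')].

    For nonnegative [h_ n], Fatou's lemma for weakly converging measures holds
    with the joint limit inferior: the functions
    [s |-> inf_(k >= m, t) (min (h_ k t) m + m d(s, t))] are bounded, Lipschitz,
    below every [h_ k] with [k >= m], and they increase with [m] to (at least)
    the joint limit inferior, so weak convergence for fixed [m] followed by
    monotone convergence in [m] gives the inequality.

    Under (b) it is applied to [f_ n - g_ n]. Case (a) reduces to case (b) with
    the constant minorant [- K] of [max (f_ n, - K)]. *)

Import Order.TTheory GRing.Theory Num.Theory.
Import numFieldNormedType.Exports.

Local Open Scope classical_set_scope.
Local Open Scope ring_scope.

(** * Lipschitz minorants of a sequence of nonnegative functions *)

(** An infimal convolution (Pasch-Hausdorff envelope) with [m%:R * mdist]. The one index [m] serves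
    as first index of the tail, truncation level and Lipschitz constant, so that a single increasing
    sequence results. *)
Definition lipschitz_minorant {R : realType} {M : metricType R}
    (h : (M -> R)^nat) (m : nat) (s : M) : R :=
  inf [set Num.min (h k t) m%:R + m%:R * mdist s t |
    k in [set k | (m <= k)%N] & t in [set: M]].

Section lipschitz_minorant.
Context {R : realType} {M : metricType R} (h : (M -> R)^nat).
Hypothesis h_ge0 : forall k s, 0 <= h k s.

Let term_ge0 m k (s t : M) : 0 <= Num.min (h k t) m%:R + m%:R * mdist s t.
Proof.
by rewrite addr_ge0 ?mulr_ge0 ?mdist_ge0 ?ler0n// le_min h_ge0 ler0n.
Qed.

Lemma lipschitz_minorant_le_term m k (s t : M) : (m <= k)%N ->
  lipschitz_minorant h m s <= Num.min (h k t) m%:R + m%:R * mdist s t.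
Proof.
move=> mk; apply: ge_inf; last by exists k => //; exists t.
by exists 0 => _ [i _ [y _ <-]]; exact: term_ge0.
Qed.

Lemma le_lipschitz_minorant m (s : M) (a : R) :
  (forall k t, (m <= k)%N -> a <= Num.min (h k t) m%:R + m%:R * mdist s t) ->
  a <= lipschitz_minorant h m s.
Proof.
move=> aP; apply: lb_le_inf; last by move=> _ [k mk [t _ <-]]; exact: aP.
by exists (Num.min (h m s) m%:R + m%:R * mdist s s), m => //=; exists s.
Qed.

Lemma lipschitz_minorant_ge0 m s : 0 <= lipschitz_minorant h m s.
Proof. by apply: le_lipschitz_minorant => k t _; exact: term_ge0. Qed.

Lemma lipschitz_minorant_le_min m k s : (m <= k)%N ->
  lipschitz_minorant h m s <= Num.min (h k s) m%:R.
Proof.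
by move=> /(lipschitz_minorant_le_term _ _ s s); rewrite mdistxx mulr0 addr0.
Qed.

Lemma lipschitz_minorant_nd s :
  nondecreasing_seq (fun m => lipschitz_minorant h m s).
Proof.
move=> m n mn; apply: le_lipschitz_minorant => k t nk.
apply: (le_trans (lipschitz_minorant_le_term _ _ s t (leq_trans mn nk))).
have mnR : m%:R <= n%:R :> R by rewrite ler_nat.
rewrite lerD ?ler_wpM2r ?mdist_ge0// le_min !ge_min lexx/=.
by rewrite mnR orbT.
Qed.

Lemma lipschitz_minorant_lipschitz m s t :
  lipschitz_minorant h m s <= lipschitz_minorant h m t + m%:R * mdist s t.
Proof.
rewrite -lerBlDr; apply: le_lipschitz_minorant => k y mk.
rewrite lerBlDr; apply: (le_trans (lipschitz_minorant_le_term _ _ s y mk)).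
rewrite -addrA -mulrDr lerD2l ler_wpM2l// addrC.
exact: metric_triangle.
Qed.

Lemma continuous_lipschitz_minorant m : continuous (lipschitz_minorant h m).
Proof.
move=> s; apply/cvgrPdist_lt => e e0.
(* Dividing by [m.+1] rather than [m] covers the Lipschitz constant [0]. *)
have d0 : 0 < e / m.+1%:R by rewrite divr_gt0.
near=> t.
have dst : mdist s t < e / m.+1%:R.
  near: t; rewrite -/(nbhs s _); apply/nbhs_ballP.
  by exists (e / m.+1%:R) => //= y; rewrite ballEmdist.
have mdst : m%:R * mdist s t < e.
  apply: (@le_lt_trans _ _ (m.+1%:R * mdist s t)).
    by rewrite ler_wpM2r ?mdist_ge0// ler_nat.
  by rewrite mulrC -ltr_pdivlMr.
have := lipschitz_minorant_lipschitz m s t.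
have := lipschitz_minorant_lipschitz m t s; rewrite (metric_sym t s) => ts st.
by rewrite ltr_norml; apply/andP; split; lra.
Unshelve. all: by end_near. Qed.

(** Terms with [t] in the ball are controlled by the bound on [h]; outside it the penalty
    [m%:R * mdist s t] alone reaches [a] once [m] exceeds [a / delta]. Also [m] must exceed [a], so
    that truncation does no harm, and [N]. *)
Lemma lipschitz_minorant_eventually_ge s (a : R) :
  (exists N, exists2 delta : R, 0 < delta &
    forall k t, (N <= k)%N -> ball s delta t -> a <= h k t) ->
  exists m, a <= lipschitz_minorant h m s.
Proof.
move=> [N [delta delta0 aP]].
pose m := maxn N (maxn (Num.truncn a).+1 (Num.truncn (a / delta)).+1).
have am : a <= m%:R.
  apply: (le_trans (ltW (truncnS_gt _))).
  by rewrite ler_nat /m !leq_max leqnn !orbT.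
have adm : a <= m%:R * delta.
  rewrite -ler_pdivrMr//; apply: (le_trans (ltW (truncnS_gt _))).
  by rewrite ler_nat /m !leq_max leqnn !orbT.
exists m; apply: le_lipschitz_minorant => k t mk.
have Nk : (N <= k)%N by apply: leq_trans mk; rewrite leq_maxl.
have [st|st] := ltP (mdist s t) delta.
  rewrite ler_wpDr ?mulr_ge0 ?mdist_ge0// le_min am andbT.
  by apply: aP => //; rewrite ballEmdist.
apply: (le_trans adm); rewrite ler_wpDl ?le_min ?h_ge0 ?ler0n//.
by rewrite ler_wpM2l.
Qed.

End lipschitz_minorant.

(** * Fatou's lemma for weakly converging measures, nonnegative case *)

Local Open Scope ereal_scope.

Lemma ereal_lt_dense {R : realFieldType} (a b : \bar R) : a < b ->
  exists r : R, a < r%:E < b.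
Proof.
case: a b => [a| |] [b| |]//=; rewrite ?lte_fin => ab.
- by exists ((a + b) / 2)%R; rewrite !lte_fin !midf_lt.
- by exists (a + 1)%R; rewrite lte_fin ltrDl ltr01 ltry.
- by exists (b - 1)%R; rewrite lte_fin ltrBlDr ltrDl ltr01 ltNyr.
- by exists 0%R; rewrite ltry ltNyr.
Qed.

Lemma continuous_borel_measurable {R : realType} {S : pmetricType R}
    (h : borel S -> R) :
  continuous h -> measurable_fun [set: borel S] h.
Proof.
move=> /continuousP ch; apply: (measurability _ (RGenOpens.measurableE R)).
move=> _ [_ [a [b ->]] <-]; rewrite setTI.
by apply: sub_sigma_algebra; apply: ch; exact: interval_open.
Qed.

Section weak_fatou.
Context {R : realType} {S : pmetricType R}.
Variables (mu_ : {measure set (borel S) -> \bar R}^nat).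
Variable mu : {finite_measure set (borel S) -> \bar R}.
Hypothesis mu_mu : weakly_converges mu_ mu.

(** The almost everywhere hypothesis places [u] below the joint limit inferior of [h]. It is phrased
    with real levels [a], so [u] may take the value [+oo]. *)
Lemma weak_fatou (h : (borel S -> R)^nat) (u : borel S -> \bar R)
    (b : (\bar R)^nat) (l : \bar R) :
  (forall n, measurable_fun setT (h n)) -> (forall n s, 0 <= h n s)%R ->
  (\forall n \near \oo, \int[mu_ n]_s (h n s)%:E <= b n) -> b @ \oo --> l ->
  measurable_fun setT u -> (forall s, 0 <= u s) ->
  (\forall s \ae mu, forall a : R, a%:E < u s ->
    exists N, exists2 delta : R, (0 < delta)%R &
      forall k t, (N <= k)%N -> ball (s : S) delta t -> (a <= h k t)%R) ->
  \int[mu]_s u s <= l.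
Proof.
move=> mh h0 hb bl mUu u0 uh.
pose psi : (borel S -> R)^nat := lipschitz_minorant (h : (S -> R)^nat).
pose phi m (s : borel S) : \bar R := (psi m s)%:E.
have cphi m : continuous (psi m).
  exact: continuous_lipschitz_minorant.
have mphi m : measurable_fun [set: borel S] (phi m).
  by apply/measurable_EFinP; exact: continuous_borel_measurable.
have phi0 m s : 0 <= phi m s by rewrite lee_fin lipschitz_minorant_ge0.
have ndphi (s : borel S) : {homo phi^~ s : m n / (m <= n)%N >-> m <= n}.
  by move=> m n mn; rewrite lee_fin; exact: lipschitz_minorant_nd.
have cvgphi s : cvgn (phi^~ s) by exact/ereal_nondecreasing_is_cvgn/ndphi.
have phil m : \int[mu]_s phi m s <= l.
  have bphi : [bounded psi m s | s in [set: borel S]].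
    exists m%:R; split; first exact: num_real.
    move=> x mx s _; rewrite /= ger0_norm ?lipschitz_minorant_ge0//.
    apply: le_trans (ltW mx).
    apply: le_trans (lipschitz_minorant_le_min _ h0 m m s _) _ => //.
    by rewrite ge_min lexx orbT.
  (* Here [m] is fixed: [psi m] is a legitimate test function, and it lies below [h n] as soon as
     [m <= n]. *)
  apply: (lee_cvg_to (mu_mu _ (cphi m) bphi) bl).
  near=> n; apply: (@le_trans _ _ (\int[mu_ n]_s (h n s)%:E)); last by near: n.
  apply: ge0_le_integral => //.
  - by move=> s _; exact: phi0.
  - exact: mphi.
  - by apply/measurable_EFinP.
  - move=> s _; rewrite lee_fin.
    have mn : (m <= n)%N by near: n; exact: nbhs_infty_ge.
    apply: le_trans (lipschitz_minorant_le_min _ h0 m n s mn) _.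
    by rewrite ge_min lexx.
apply: (@le_trans _ _ (\int[mu]_s limn (phi^~ s))); last first.
  rewrite (monotone_convergence mu measurableT)//.
  apply: lime_le; last exact: nearW.
  apply: ereal_nondecreasing_is_cvgn => m n mn.
  by apply: ge0_le_integral => // s _; exact: ndphi.
apply: ae_ge0_le_integral => //.
- by move=> s _; apply: lime_ge => //; exact: nearW.
- by apply: (emeasurable_fun_cvg phi) => // s _; exact: cvgphi.
(* A real level strictly between the limit of [phi] and [u s] would be reached by some [psi m],
   which is absurd. *)
apply: filterS uh => s uh _; rewrite leNgt; apply/negP => /ereal_lt_dense[a].
move=> /andP[phia /uh /(lipschitz_minorant_eventually_ge _ h0)[m am]].
move: phia; apply/negP; rewrite -leNgt.
apply: (@le_trans _ _ (phi m s)); first by rewrite lee_fin.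
rewrite (cvg_lim _ (ereal_nondecreasing_cvgn (ndphi s)))//.
by apply: ereal_sup_ubound; exists m.
Unshelve. all: by end_near. Qed.

End weak_fatou.

(** * Comparison and integrability for extended real integrands *)

Section integral.
Context d (T : measurableType d) (R : realType) (mu : {measure set T -> \bar R}).
Implicit Types f g : T -> \bar R.

(* The convention [+oo - oo = -oo] keeps subtraction monotone, so this includes
   functions whose integral is mathematically undefined. *)
Lemma ae_le_integral f g :
  measurable_fun setT f -> measurable_fun setT g ->
  (\forall s \ae mu, f s <= g s) ->
  \int[mu]_s f s <= \int[mu]_s g s.
Proof.
move=> mf mg fg; rewrite (integralE mu setT f) (integralE mu setT g).
apply: leeB; apply: ae_ge0_le_integral => //; try exact: measurable_funepos;
  try exact: measurable_funeneg.
- by apply: filterS fg => s fgs _; rewrite !funeposE ge_max !le_max fgs lexx orbT.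
- apply: filterS fg => s fgs _.
  by rewrite !funenegE ge_max !le_max leeN2 fgs lexx orbT.
Qed.

(** If either part had infinite integral, the difference would be infinite too, even under the
    convention [+oo - oo = -oo]. *)
Lemma fin_num_integral_integrable f : measurable_fun setT f ->
  \int[mu]_s f s \is a fin_num -> mu.-integrable setT f.
Proof.
move=> mf; rewrite integralE => intf.
have p0 : 0 <= \int[mu]_s f^\+ s by exact: integral_ge0.
have n0 : 0 <= \int[mu]_s f^\- s by exact: integral_ge0.
apply/integrableP; split => //.
rewrite -/(abse \o f) fune_abse ge0_integralD//; last 2 first.
- exact: measurable_funepos.
- exact: measurable_funeneg.
by case: (\int[mu]_s f^\+ s) (\int[mu]_s f^\- s) p0 n0 intf
  => [p| |] [n| |]//= _ _ _; rewrite -EFinD ltry.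
Qed.

End integral.

(** * Bounding the integral of [f] from almost everywhere lower bounds *)

(** Truncation from below thus preserves both lower semi-equicontinuity and the pointwise lower
    bound by [f]. *)
Lemma ltr_max_sub {R : realDomainType} (x y k r : R) :
  (0 < r -> x - r < y -> Num.max x k - r < Num.max y k)%R.
Proof.
move=> r0 xy; rewrite ltrBlDr gt_max -!ltrBlDr !lt_max xy/=.
by rewrite [(k - r < k)%R]ltrBlDr ltrDl r0 orbT.
Qed.

Section fatou.
Context {R : realType} {S : pmetricType R}.
Variables (mu_ : {measure set (borel S) -> \bar R}^nat).
Variable mu : {finite_measure set (borel S) -> \bar R}.
Hypothesis mu_mu : weakly_converges mu_ mu.

(** [G] dominates the joint limit superior of [g_]; keeping it abstract allows a constant as well.
    Fatou's lemma for [f_ n - g_ n] bounds the integral of [u], the positive part of [f - G], and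
    then [f <= G + u] is integrated. *)
Lemma integral_le_of_minorant (f_ g_ : (borel S -> R)^nat) (f : borel S -> R)
    (G : borel S -> \bar R) (c : R) :
  lower_semi_equicontinuous f_ ->
  measurable_fun setT f -> (forall n, measurable_fun setT (f_ n)) ->
  (forall n, measurable_fun setT (g_ n)) -> (forall n s, (g_ n s <= f_ n s)%R) ->
  (\forall s \ae mu, forall e : R, (0 < e)%R ->
    \forall n \near \oo, (f s - e < f_ n s)%R) ->
  (forall s (r : R), G s < r%:E -> exists N, exists2 delta : R, (0 < delta)%R &
    forall k t, (N <= k)%N -> ball (s : S) delta t -> (g_ k t <= r)%R) ->
  mu.-integrable setT G ->
  (forall r : R, r%:E < \int[mu]_s G s ->
    \forall n \near \oo, r%:E < \int[mu_ n]_s (g_ n s)%:E) ->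
  (\forall n \near \oo, \int[mu_ n]_s (f_ n s)%:E <= c%:E) ->
  \int[mu]_s (f s)%:E <= c%:E.
Proof.
move=> lsc mf mf_ mg_ gf f_f GP iG intG intf.
have mG := measurable_int _ iG.
have fG : \int[mu]_s G s \is a fin_num by exact: integrable_fin_num.
have mEf : measurable_fun setT (EFin \o f) by exact/measurable_EFinP.
pose u (s : borel S) := maxe ((f s)%:E - G s) 0.
have mU : measurable_fun setT u.
  apply: measurable_maxe; last exact: measurable_cst.
  exact: emeasurable_funB.
have u0 s : 0 <= u s by rewrite le_max lexx orbT.
have Uc : \int[mu]_s u s <= c%:E - \int[mu]_s G s.
  (* The slack [e] is there because [intG] only yields integrals of [g_ n] eventually above that of
     [G] minus [e]. *)
  apply/lee_addgt0Pr => e e0.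
  apply: (weak_fatou mu_ mu mu_mu (fun n s => f_ n s - g_ n s)%R _
    (fun=> c%:E - \int[mu]_s G s + e%:E)) => //.
  - by move=> n; exact: measurable_funB.
  - by move=> n s; rewrite subr_ge0.
  - have Ge : (fine (\int[mu]_s G s) - e)%:E < \int[mu]_s G s.
      by rewrite EFinB fineK// lteBlDr// lteDl// lte_fin.
    near=> n.
    have gn : (fine (\int[mu]_s G s) - e)%:E < \int[mu_ n]_s (g_ n s)%:E.
      by near: n; exact: intG.
    have fn : \int[mu_ n]_s (f_ n s)%:E <= c%:E by near: n.
    have gfn : \int[mu_ n]_s (g_ n s)%:E <= \int[mu_ n]_s (f_ n s)%:E.
      apply: ae_le_integral; [exact/measurable_EFinP..|].
      by apply: aeW => s; rewrite lee_fin.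
    (* Both integrals are squeezed between a real lower bound from [gn] and [c], which makes the
       integral of the difference split. *)
    have fing : \int[mu_ n]_s (g_ n s)%:E \is a fin_num.
      rewrite fin_numElt (lt_trans _ gn) ?ltNyr//=.
      by rewrite (le_lt_trans gfn)// (le_lt_trans fn)// ltry.
    have finf : \int[mu_ n]_s (f_ n s)%:E \is a fin_num.
      rewrite fin_numElt (lt_le_trans _ gfn) ?(lt_trans _ gn) ?ltNyr//=.
      by rewrite (le_lt_trans fn)// ltry.
    under eq_integral do rewrite EFinB.
    rewrite integralB//; last 2 first.
    + by apply: fin_num_integral_integrable => //; exact/measurable_EFinP.
    + by apply: fin_num_integral_integrable => //; exact/measurable_EFinP.
    rewrite -(fineK fing) -(fineK finf) -(fineK fG) -EFinB -EFinB -EFinD lee_fin.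
    move: gn fn; rewrite -(fineK fing) -(fineK finf) lte_fin lee_fin => gn fn.
    lra.
  - exact: cvg_cst.
  - have Gfin := integrable_ae measurableT iG.
    apply: filterS2 f_f Gfin => s f_fs /(_ Logic.I) Gs a.
    rewrite lt_max => /orP[|]; last first.
      rewrite lte_fin => a0; exists 0%N, 1%R => // k t _ _.
      by rewrite (le_trans (ltW a0))// subr_ge0.
    rewrite -(fineK Gs) -EFinB lte_fin => aG.
    (* One third each for passing from [f s] to [f_ k s], from [f_ k s] to [f_ k t], and from [G s]
       to [g_ k t]. *)
    pose eps := ((f s - fine (G s) - a) / 3)%R.
    have eps0 : (0 < eps)%R by rewrite divr_gt0// subr_gt0.
    have [N1 _ fN1] := f_fs _ eps0.
    have [d1 d10 fd1] := lsc s _ eps0.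
    have [N2 [d2 d20 gN2]] : exists N, exists2 delta : R, (0 < delta)%R &
        forall k t, (N <= k)%N -> ball (s : S) delta t ->
        (g_ k t <= fine (G s) + eps)%R.
      by apply: GP; rewrite -{1}(fineK Gs) lte_fin ltrDl.
    exists (maxn N1 N2), (Num.min d1 d2); first by rewrite lt_min d10.
    move=> k t; rewrite geq_max => /andP[N1k N2k] st.
    have := fN1 _ N1k; have := fd1 k t (le_ball _ st).
    rewrite ge_min lexx => /(_ isT) /=.
    have := gN2 k t N2k (le_ball _ st); rewrite ge_min lexx orbT => /(_ isT).
    rewrite /eps; lra.
have Ufin : \int[mu]_s u s \is a fin_num.
  rewrite ge0_fin_numE ?integral_ge0// (le_lt_trans Uc)//.
  by rewrite -(fineK fG) -EFinB ltry.
have iU : mu.-integrable setT u by exact: fin_num_integral_integrable.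
apply: (@le_trans _ _ (\int[mu]_s (G s + u s))).
  apply: ae_le_integral => //; first exact: emeasurable_funD.
  have Gfin := integrable_ae measurableT iG.
  apply: filterS Gfin => s /(_ Logic.I) Gs.
  by rewrite -leeBlDl// le_max lexx.
rewrite integralD//.
by apply: (le_trans (leeD2l _ Uc)); rewrite addeC subeK.
Unshelve. all: by end_near. Qed.

(** Raising [f_ n] to [max (f_ n, - K)] adds at most the part of its negative part with values at
    least [K], whose integral is eventually at most [e]. The truncated functions therefore satisfy
    the minorant case with bound [c + e]. *)
Lemma integral_le_of_uniformly_integrable (f_ : (borel S -> R)^nat)
    (f : borel S -> R) (c : R) :
  lower_semi_equicontinuous f_ ->
  measurable_fun setT f -> (forall n, measurable_fun setT (f_ n)) ->
  (\forall s \ae mu, forall e : R, (0 < e)%R ->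
    \forall n \near \oo, (f s - e < f_ n s)%R) ->
  (forall e : R, (0 < e)%R -> exists2 K : R, (0 <= K)%R & \forall n \near \oo,
    \int[mu_ n]_(s in [set s | (K <= `|(f_ n)^\-%R s|)%R]) `|(f_ n)^\-%R s|%:E
      <= e%:E) ->
  (\forall n \near \oo, \int[mu_ n]_s (f_ n s)%:E <= c%:E) ->
  \int[mu]_s (f s)%:E <= c%:E.
Proof.
move=> lsc mf mf_ f_f aui intf.
apply/lee_addgt0Pr => e e0; rewrite -EFinD.
have [K K0 auiK] := aui e e0.
(* Testing with the constant [1] gives convergence of total masses: it controls the integrals of
   [- K] and makes [mu_ n] eventually finite. *)
have muT : mu_ n setT @[n --> \oo] --> mu setT.
  have intT (nu : {measure set (borel S) -> \bar R}) :
      \int[nu]_s (cst 1%R s : R)%:E = nu setT.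
    by rewrite (integral_cst nu measurableT 1%:E) mul1e.
  have c1 : continuous (cst 1%R : borel S -> R) by move=> s; exact: cvg_cst.
  have := mu_mu _ c1 (bounded_cst _ _).
  by rewrite intT (eq_cvg _ _ (fun n => intT (mu_ n))).
have fin_muT : mu setT \is a fin_num by exact: fin_num_measure.
apply: (@le_trans _ _ (\int[mu]_s (Num.max (f s) (- K))%:E)).
  apply: ae_le_integral; [exact/measurable_EFinP| |].
    by apply/measurable_EFinP; exact: (measurable_maxr mf (measurable_cst _)).
  by apply: aeW => s; rewrite lee_fin le_max lexx.
apply: (@integral_le_of_minorant (fun n s => Num.max (f_ n s) (- K))%R
    (fun _ _ => - K)%R _ (cst (- K)%:E)) => //.
- move=> s r r0; have [delta delta0 fd] := lsc s r r0.
  by exists delta => // n t /(fd n); exact: ltr_max_sub.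
- exact: (measurable_maxr mf (measurable_cst _)).
- by move=> n; exact: (measurable_maxr (mf_ n) (measurable_cst _)).
- by move=> n s; rewrite le_max lexx orbT.
- apply: filterS f_f => s f_fs r r0; apply: filterS (f_fs r r0) => n.
  exact: ltr_max_sub.
- move=> s r; rewrite lte_fin => Kr; exists 0%N, 1%R => // k t _ _.
  exact: ltW.
- exact: finite_measure_integrable_cst.
- move=> r; rewrite integral_cst// => rK.
  have KmuT : (- K)%:E * mu_ n setT @[n --> \oo] --> (- K)%:E * mu setT.
    exact: cvgeZl.
  have rKmu : \forall n \near \oo, r%:E < (- K)%:E * mu_ n setT.
    exact: (KmuT _ (open_ereal_gt' rK)).
  by near=> n; rewrite integral_cst//; near: n.
- have muTfin : \forall n \near \oo, mu_ n setT < +oo.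
    have ltT : mu setT < +oo by rewrite -ge0_fin_numE.
    exact: (muT _ (open_ereal_lt' ltT)).
  near=> n.
  have mn : mu_ n setT < +oo by near: n.
  have fn : \int[mu_ n]_s (f_ n s)%:E <= c%:E by near: n.
  have : \int[mu_ n]_(s in [set s | (K <= `|(f_ n)^\-%R s|)%R])
      `|(f_ n)^\-%R s|%:E <= e%:E by near: n.
  set A := [set s | (K <= `|(f_ n)^\-%R s|)%R] => An.
  have mA : measurable A.
    have : measurable_fun [set: borel S] (fun s => `|(f_ n)^\-%R s|)%R.
      apply: measurableT_comp => //.
      exact: measurable_funrneg.
    move=> /(_ measurableT _ (measurable_itv `[K, +oo[)); rewrite setTI.
    by rewrite preimage_itvcy.
  pose w := (fun s => `|(f_ n)^\-%R s|%:E) \_ A.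
  have w0 s : 0 <= w s by apply: erestrict_ge0 => t _; rewrite lee_fin.
  have mw : measurable_fun [set: borel S] w.
    apply/(measurable_restrictT _ mA)/measurable_EFinP.
    apply: measurableT_comp => //; apply: measurable_funTS.
    exact: measurable_funrneg.
  have we : \int[mu_ n]_s w s <= e%:E by rewrite -integral_mkcond.
  have fK s : - (f_ n s)%:E <= K%:E + w s.
    rewrite /w patchE; case: ifPn => [_|/negP nA].
      rewrite -EFinN -EFinD lee_fin (@ger0_norm _ ((f_ n)^\-%R s)) ?funrneg_ge0//.
      by rewrite ler_wpDl// le_max lexx.
    rewrite adde0 -EFinN lee_fin leNgt; apply/negP => Kf.
    apply: nA; rewrite inE /A /= ger0_norm ?funrneg_ge0//.
    by rewrite le_max (ltW Kf).
  have fw s : (Num.max (f_ n s) (- K))%:E <= (f_ n s)%:E + w s.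
    have K0' : 0 <= K%:E by rewrite lee_fin.
    rewrite EFin_max ge_max leeDl ?w0//=.
    rewrite /w patchE; case: ifPn => [_|/negP nA].
      rewrite -EFinD lee_fin (@ger0_norm _ ((f_ n)^\-%R s)) ?funrneg_ge0//.
      rewrite (@le_trans _ _ 0%R) ?oppr_le0// -lerBlDl sub0r.
      by rewrite le_max lexx.
    rewrite adde0 lee_fin leNgt; apply/negP => Kf.
    apply: nA; rewrite inE /A /= ger0_norm ?funrneg_ge0//.
    by rewrite le_max lerNr (ltW Kf).
  have mEf : measurable_fun setT (EFin \o f_ n) by exact/measurable_EFinP.
  (* The negative part is at most [K + w], integrable since [mu_ n] has finite mass; with the upper
     bound [c] this makes [f_ n] integrable, so that the integral of [f_ n + w] splits. *)
  have intN : \int[mu_ n]_s (EFin \o f_ n)^\- s < +oo.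
    apply: (@le_lt_trans _ _ (\int[mu_ n]_s (K%:E + w s))).
      apply: ge0_le_integral => //.
      - exact: measurable_funeneg.
      - exact: emeasurable_funD.
      - move=> s _; rewrite funenegE ge_max fK/=.
        by rewrite adde_ge0 ?lee_fin.
    rewrite ge0_integralD// integral_cst// lte_add_pinfty//; last first.
      by rewrite (le_lt_trans we) ?ltry.
    by rewrite lte_mul_pinfty ?lee_fin.
  have finf : \int[mu_ n]_s (f_ n s)%:E \is a fin_num.
    rewrite fin_numElt (le_lt_trans fn) ?ltry// andbT integralE.
    have intP : 0 <= \int[mu_ n]_s (EFin \o f_ n)^\+ s by exact: integral_ge0.
    rewrite (@lt_le_trans _ _ (- \int[mu_ n]_s (EFin \o f_ n)^\- s))//.
      by rewrite lteNr.
    by rewrite leeDr.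
  have finw : \int[mu_ n]_s w s \is a fin_num.
    by rewrite ge0_fin_numE ?integral_ge0// (le_lt_trans we) ?ltry.
  apply: (@le_trans _ _ (\int[mu_ n]_s ((f_ n s)%:E + w s))).
    apply: ae_le_integral.
    + apply/measurable_EFinP; exact: (measurable_maxr (mf_ n) (measurable_cst _)).
    + exact: emeasurable_funD.
    + exact: aeW.
  rewrite integralD//; last 2 first.
  + exact: fin_num_integral_integrable.
  + exact: fin_num_integral_integrable.
  by rewrite EFinD leeD.
Unshelve. all: by end_near. Qed.

End fatou.

(** * Extracting bounds from upper and lower limits, and Borel-Cantelli *)

Lemma limn_einf_lt {R : realType} (u : (\bar R)^nat) (c : \bar R) :
  limn_einf u < c -> forall N, exists2 n, (N <= n)%N & u n < c.
Proof.
move=> uc N; apply: contrapT => /forall2NP uN.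
move: uc; apply/negP; rewrite -leNgt limn_einf_lim.
rewrite (cvg_lim _ (@cvg_einfs_sup _ _))//.
apply: (@le_trans _ _ (einfs u N)); last by apply: ereal_sup_ubound; exists N.
apply: le_ereal_inf_tmp => _ [n /= Nn <-].
by have [//|/negP] := uN n; rewrite -leNgt.
Qed.

Lemma lt_limn_einf {R : realType} (u : (\bar R)^nat) (r : \bar R) :
  r < limn_einf u -> \forall n \near \oo, r < u n.
Proof.
rewrite limn_einf_lim (cvg_lim _ (@cvg_einfs_sup _ _))//.
move=> /ereal_sup_gt[_ [N _ <-]] ruN.
exists N => // n /= Nn; apply: (lt_le_trans ruN).
by apply: ereal_inf_lbound; exists n.
Qed.

Lemma limn_esup_lt {R : realType} (u : (\bar R)^nat) (r : \bar R) :
  limn_esup u < r -> \forall n \near \oo, u n < r.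
Proof.
move=> /ereal_inf_lt[_ [V nV <-]] Vr; apply: filterS nV => n Vn.
by apply: le_lt_trans Vr; apply: ereal_sup_ubound; exists n.
Qed.

(* The indices [sigma k] need not increase: dominating [k] is enough. *)
Lemma near_comp_ge (sigma : nat -> nat) (P : nat -> Prop) :
  (forall k, (k <= sigma k)%N) -> (\forall n \near \oo, P n) ->
  \forall k \near \oo, P (sigma k).
Proof.
move=> sigma_ge [N _ NP]; exists N => // k /= Nk.
by apply: NP => /=; exact: leq_trans (sigma_ge k).
Qed.

Lemma joint_limsup_lt {R : realType} {S : pmetricType R} (g_ : (S -> R)^nat)
    (s : S) (r : R) :
  joint_limsup g_ s < r%:E -> exists N, exists2 delta : R, (0 < delta)%R &
    forall k t, (N <= k)%N -> ball s delta t -> (g_ k t <= r)%R.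
Proof.
move=> /ereal_inf_lt[_ [N _ [delta delta0 <-]] gr].
exists N, delta => // k t Nk st; rewrite -lee_fin; apply: le_trans (ltW gr).
by apply: ereal_sup_ubound; exists k => //; exists t.
Qed.

Lemma asymptotically_uniformly_integrable_near d (T : measurableType d)
    (R : realType) (mu_ : {measure set T -> \bar R}^nat) (h_ : (T -> R)^nat) :
  asymptotically_uniformly_integrable mu_ h_ ->
  forall e : R, (0 < e)%R -> exists2 K : R, (0 <= K)%R & \forall n \near \oo,
    \int[mu_ n]_(s in [set s | (K <= `|h_ n s|)%R]) `|h_ n s|%:E <= e%:E.
Proof.
move=> aui e e0.
have eE0 : 0 < e%:E by rewrite lte_fin.
have near_e : \forall K \near +oo%R, limn_esup (fun n =>
    \int[mu_ n]_(s in [set s | (K <= `|h_ n s|)%R]) `|h_ n s|%:E) < e%:E.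
  exact: (aui _ (open_ereal_lt' eE0)).
have [K [K0 Ke]] : exists K : R, (0 <= K)%R /\ limn_esup (fun n =>
    \int[mu_ n]_(s in [set s | (K <= `|h_ n s|)%R]) `|h_ n s|%:E) < e%:E.
  by apply/(@filter_ex _ +oo%R); apply: filterI near_e; exact: nbhs_pinfty_ge.
exists K => //; apply: filterS (limn_esup_lt _ _ Ke) => n; exact: ltW.
Qed.

Lemma borel_cantelli d (T : measurableType d) (R : realType)
    (mu : {measure set T -> \bar R}) (F : (set T)^nat) :
  (forall k, measurable (F k)) -> \sum_(k <oo) mu (F k) < +oo ->
  \forall s \ae mu, \forall k \near \oo, ~ F k s.
Proof.
move=> mF sumF; exists (lim_sup_set F); split.
- by apply: bigcap_measurableType => n _; exact: bigcup_measurable.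
- exact: lim_sup_set_cvg0.
- move=> s /= sF n _; apply: contrapT => nF; apply: sF.
  exists n => // k /= nk Fks.
  by apply: nF; exists k.
Qed.

(** * Choice of the subsequence and treatment of the two cases *)

Theorem theorem4p1 (R : realType) (S : pmetricType R)
    (mu_ : {measure set (borel S) -> \bar R}^nat)
    (mu : {finite_measure set (borel S) -> \bar R})
    (f_ : (borel S -> R)^nat) (f : borel S -> R) :
  weakly_converges mu_ mu ->
  lower_semi_equicontinuous f_ ->
  measurable_fun [set: borel S] f ->
  integral_defined mu (EFin \o f) ->
  (forall n, integral_defined (mu_ n) (EFin \o f_ n)) ->
  lower_semi_converges_in_measure mu f_ f ->
  asymptotically_uniformly_integrable mu_ (fun n => (f_ n)^\-%R) \/
  (exists g_ : (borel S -> R)^nat,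
    [/\ forall n, measurable_fun [set: borel S] (g_ n),
        forall n s, (g_ n s <= f_ n s)%R,
        integral_defined mu (joint_limsup g_),
        forall n, integral_defined (mu_ n) (EFin \o g_ n) &
        -oo < \int[mu]_s joint_limsup g_ s
          <= limn_einf (fun n => \int[mu_ n]_s (g_ n s)%:E)]) ->
  \int[mu]_s (f s)%:E <= limn_einf (fun n => \int[mu_ n]_s (f_ n s)%:E).
Proof.
move=> mu_mu lsc mf _ deff f_f hyp.
have mf_ n : measurable_fun setT (f_ n).
  by apply/measurable_EFinP; exact: (deff n).1.
rewrite leNgt; apply/negP => /ereal_lt_dense[c /andP[fc cf]].
move: cf; apply/negP; rewrite -leNgt.
pose A n (r : R) := [set s | (f_ n s <= f s - r)%R].
have mA n r : measurable (A n r : set (borel S)).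
  rewrite -[A n r]setTI; apply: measurable_fun_le => //.
  exact: measurable_funB.
have e0 k : (0 < 1 / (2 ^ k.+1)%:R :> R)%R.
  by rewrite divr_gt0// ltr0n expn_gt0.
(* The integral bound holds for arbitrarily large [n] and the measure bound for all large [n], so
   some index beyond [k] satisfies both. The bounds [1 / 2 ^ k.+1] are summable and tend to [0], as
   Borel-Cantelli and the pointwise limit require. *)
have /choice[sigma sigmaP] : forall k : nat, exists n : nat, [/\ (k <= n)%N,
    \int[mu_ n]_s (f_ n s)%:E <= c%:E &
    mu (A n (1 / (2 ^ k.+1)%:R)%R) <= (1 / (2 ^ k.+1)%:R)%:E].
  move=> k.
  have [N _ NA] : \forall n \near \oo,
      mu (A n (1 / (2 ^ k.+1)%:R)%R) < (1 / (2 ^ k.+1)%:R)%:E.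
    have ek0 : 0 < (1 / (2 ^ k.+1)%:R : R)%:E by rewrite lte_fin.
    exact: (f_f _ (e0 k) _ (open_ereal_lt' ek0)).
  have [n + fn] := limn_einf_lt _ _ fc (maxn k N).
  rewrite geq_max => /andP[kn Nn].
  by exists n; split; [|exact: ltW|exact/ltW/NA].
have sigma_ge k : (k <= sigma k)%N by have [] := sigmaP k.
have cvg_sigma : sigma @ \oo --> \oo.
  by move=> P; exact: near_comp_ge.
have mu_sigma : weakly_converges (mu_ \o sigma) mu.
  by move=> h ch bh; apply: cvg_comp cvg_sigma (mu_mu h ch bh).
have lsc_sigma : lower_semi_equicontinuous (f_ \o sigma).
  move=> s e /(lsc s)[delta delta0 fd]; exists delta => // n.
  exact: fd.
have intf : \forall k \near \oo,
    \int[(mu_ \o sigma) k]_s ((f_ \o sigma) k s)%:E <= c%:E.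
  by apply: nearW => k; have [] := sigmaP k.
have f_sigma : \forall s \ae mu, forall e : R, (0 < e)%R ->
    \forall k \near \oo, (f s - e < (f_ \o sigma) k s)%R.
  have sumA : \sum_(k <oo) mu (A (sigma k) (1 / (2 ^ k.+1)%:R)%R) < +oo.
    apply: (@le_lt_trans _ _ 1%:E); last exact: ltry.
    apply: le_trans (epsilon_trick0 xpredT ler01).
    by apply: lee_nneseries => // k _; have [] := sigmaP k.
  apply: filterS (borel_cantelli _ _ _ mu _ _ sumA) => // s nA e e_gt0.
  near=> k.
  have : ~ A (sigma k) (1 / (2 ^ k.+1)%:R)%R s by near: k.
  move=> /negP; rewrite -ltNge; apply: le_lt_trans.
  (* For large [k], [1 / 2 ^ k.+1 <= 1 / k.+1 < e]. *)
  rewrite lerD2l lerN2 div1r (@le_trans _ _ (k.+1%:R^-1)%R)//.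
    by rewrite lef_pV2 ?posrE ?ltr0n ?expn_gt0// ler_nat ltnW// ltn_expl.
  by apply/ltW; near: k; exact: near_infty_natSinv_lt (PosNum e_gt0).
have [aui|[g_ [mg gf [mG _] _ /andP[Gy Gg]]]] := hyp.
  apply: (integral_le_of_uniformly_integrable (mu_ \o sigma)) intf => //.
  - by move=> n; exact: mf_.
  move=> e /(asymptotically_uniformly_integrable_near _ _ _ _ _ aui)[K K0 Ke].
  by exists K => //; exact: near_comp_ge Ke.
have intG (r : R) : r%:E < \int[mu]_s joint_limsup g_ s ->
    \forall k \near \oo, r%:E < \int[(mu_ \o sigma) k]_s ((g_ \o sigma) k s)%:E.
  move=> rG.
  apply: (near_comp_ge sigma (fun n => r%:E < \int[mu_ n]_s (g_ n s)%:E)) => //.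
  by apply: lt_limn_einf; exact: lt_le_trans Gg.
(* The minorant lemma needs an integrable [G]. An infinite integral is contradictory: the integrals
   of [g_] would eventually exceed [c], while those of [f_] along [sigma] do not. *)
have [Goo|Goo] := eqVneq (\int[mu]_s joint_limsup g_ s) +oo.
  have [k [gk fk]] : exists k,
      c%:E < \int[mu_ (sigma k)]_s (g_ (sigma k) s)%:E /\
      \int[mu_ (sigma k)]_s (f_ (sigma k) s)%:E <= c%:E.
    apply: (@filter_ex _ \oo); apply: filterI intf; apply: intG.
    by rewrite Goo ltry.
  have := lt_le_trans gk (le_trans _ fk); rewrite ltxx => /(_ _)/negP [] //.
  apply: ae_le_integral; [exact/measurable_EFinP..|].
  by apply: aeW => s; rewrite lee_fin.
apply: (integral_le_of_minorant (mu_ \o sigma) mu mu_sigma (f_ \o sigma)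
  (g_ \o sigma) f (joint_limsup g_)) => //.
- by move=> n; exact: mf_.
- by move=> n; exact: mg.
- by move=> n s; exact: gf.
(* The joint limit superior of the full sequence also bounds the subsequence, because
   [sigma k >= k]. *)
- move=> s r /joint_limsup_lt[N [delta delta0 gr]]; exists N, delta => // k t Nk.
  by apply: gr; exact: leq_trans (sigma_ge k).
- apply: fin_num_integral_integrable => //.
  by rewrite fin_numE Goo andbT gt_eqF.
Unshelve. all: by end_near. Qed.
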